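(* Let $a\ge2$ and $k\ge 1$ be integers, let $1\le n\le\lfloor k/2\rfloor$, and let $r_1,\dots,r_n\in\{1,\dots,k\}$ be distinct and pairwise cyclically nonconsecutive, i.e. $|r_i-r_j|\notin\{0,1,k-1\}$ for all $i\neq j$. Let $\Xi_1,\dots,\Xi_k$ be i.i.d. with density $f_\Xi$ and $\Theta_1,\dots,\Theta_k$ be i.i.d. with density $f_\Theta$, with $\Xi_{k+1}:=\Xi_1$, $\Theta_{k+1}:=\Theta_1$. Then the sum of the probability of the event $$\Xi_i\Xi_{i+1}<1\ \text{ for all } i\in\{1,\dots,k\},\quad 1\le\Xi_{r_n}\le\cdots\le\Xi_{r_1},\quad \Xi_z<1\ \text{ for all } z\notin\{r_1,\dots,r_n\}$$ and the probability of the event $$\Theta_i\Theta_{i+1}<1\ \text{ for all } i\in\{1,\dots,k\},\quad 1\le\Theta_{r_n}\le\cdots\le\Theta_{r_1},\quad \Theta_z<1\ \text{ for all } z\notin\{r_1,\dots,r_n\}$$ is equal to $J_{r_1,\dots,r_n}+K_{r_1,\dots,r_n}$, where $$J_{r_1,\dots,r_n}=\psi(1)^{\,k-n-\sum_{j=1}^n\alpha_j}\int_{1\le\xi_{r_n}\le\cdots\le\xi_{r_1}}\frac{\left(\frac{a}{\pi}\sin\frac{\pi}{a}\right)^n\psi\left(\frac{1}{\xi_{r_1}}\right)^{\alpha_1}\cdots\psi\left(\frac{1}{\xi_{r_n}}\right)^{\alpha_n}}{(1+\xi_{r_1}^a)\cdots(1+\xi_{r_n}^a)}\,d\xi_{r_n}\cdots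 d\xi_{r_1},$$ $$K_{r_1,\dots,r_n}=\phi(1)^{\,k-n-\sum_{j=1}^n\alpha_j}\int_{1\le\theta_{r_n}\le\cdots\le\theta_{r_1}}\frac{\left(\frac{a}{\pi}\sin\frac{\pi}{a}\right)^n\phi\left(\frac{1}{\theta_{r_1}}\right)^{\alpha_1}\theta_{r_1}^{a-2}\cdots\phi\left(\frac{1}{\theta_{r_n}}\right)^{\alpha_n}\theta_{r_n}^{a-2}}{(1+\theta_{r_1}^a)\cdots(1+\theta_{r_n}^a)}\,d\theta_{r_n}\cdots d\theta_{r_1}.$$
   Context: The densities are $f_{\Xi}(\xi)=\dfrac{\frac{a}{\pi}\sin(\frac{\pi}{a})}{1+\xi^a}$ for $\xi\ge 0$ and $f_{\Theta}(\theta)=\dfrac{\frac{a}{\pi}\sin(\frac{\pi}{a})\,\theta^{a-2}}{1+\theta^a}$ for $\theta\ge0$ (zero on the negative half-line), and $\psi(t)=\int_0^t f_\Xi(\xi)\,d\xi$, $\phi(t)=\int_0^t f_\Theta(\theta)\,d\theta$ are the corresponding cumulative distribution functions. For $j\in\{1,\dots,n\}$, $\alpha_j$ is the number of variables $\Xi_z$ (equivalently $\Theta_z$) with $z$ cyclically adjacent to $r_j$ whose upper bound, under the constraints of the event, is $1/\Xi_{r_j}$ (resp. $1/\Theta_{r_j}$). Explicitly: $\alpha_j$ is the number of distinct indices $z\in\{r_j-1,r_j+1\}$ (taken cyclically mod $k$ in $\{1,\dots,k\}$) that are not cyclically adjacent to $r_m$ for any $m<j$ (i.e. $z\not\equiv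 r_m\pm1\pmod k$ for all $m<j$). *)

(* Defs.v *)
From mathcomp Require Import all_boot all_order all_algebra.
From mathcomp Require Import all_classical all_reals all_analysis.

Set Implicit Arguments.
Unset Strict Implicit.
Unset Printing Implicit Defensive.

Import Order.TTheory GRing.Theory Num.Theory.
Import numFieldNormedType.Exports.

Local Open Scope classical_set_scope.
Local Open Scope ring_scope.

(* The indices 1, ..., k are the elements 0, ..., k - 1 of 'I_k,
   and j = 1, ..., n are those of 'I_n; [ordS] and [ord_pred] are the
   cyclic successor and predecessor modulo k. *)

Section densities.
Context {R : realType}.

Definition norm_const (a : nat) : R := a%:R / pi * sin (pi / a%:R).

Definition f_Xi (a : nat) (x : R) : R :=
  if 0 <= x then norm_const a / (1 + x ^+ a) else 0.

Definition f_Theta (a : nat) (x : R) : R :=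
  if 0 <= x then norm_const a * x ^+ (a - 2) / (1 + x ^+ a) else 0.

Definition psi (a : nat) (t : R) : R :=
  Rintegral lebesgue_measure `[0, t] (f_Xi a).

Definition phi (a : nat) (t : R) : R :=
  Rintegral lebesgue_measure `[0, t] (f_Theta a).

End densities.

Section iid.
Context {d : measure_display} {T : measurableType d} {R : realType}.
Variable P : probability T R.

Definition has_density (X : {RV P >-> R}) (f : R -> R) : Prop :=
  forall A : set R, measurable A ->
    distribution P X A = (\int[lebesgue_measure]_(x in A) (f x)%:E)%E.

Definition mutually_independent (I : finType) (X : I -> {RV P >-> R}) : Prop :=
  forall (S : {set I}) (A : I -> set R), (forall i, measurable (A i)) ->
    P [set w | forall i, i \in S -> A i (X i w)] =
    (\prod_(i in S) P (X i @^-1` A i))%E.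

Definition iid_with_density (I : finType) (X : I -> {RV P >-> R})
    (f : R -> R) : Prop :=
  mutually_independent X /\ forall i, has_density (X i) f.

End iid.

Definition cyclically_nonconsecutive (k n : nat) (r : 'I_n -> 'I_k) : Prop :=
  forall i j : 'I_n, i != j ->
    absz ((r i)%:Z - (r j)%:Z) \notin [:: 0; 1; k - 1]%N.

Definition cyc_adjacent (k : nat) (z s : 'I_k) : bool :=
  (z == ord_pred s) || (z == ordS s).

(* Being a cardinality, this counts a neighbour once when k = 2, where the two
   neighbours of r j coincide. *)
Definition alpha (k n : nat) (r : 'I_n -> 'I_k) (j : 'I_n) : nat :=
  #|[pred z : 'I_k | cyc_adjacent z (r j) &
      [forall m : 'I_n, (m < j)%N ==> ~~ cyc_adjacent z (r m)]]|.

Section integrals.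
Context {R : realType}.

(* x_1 >= x_2 >= ... >= x_n >= 1 *)
Definition ordered_above_one (n : nat) (x : n.-tuple R) : bool :=
  sorted (fun u v : R => v <= u) (rcons x 1).

(* Lebesgue integral over R^n, as an iterated integral with the first variable
   outermost.  It is only used for nonnegative measurable F, where by Tonelli
   the order is immaterial and the value is the integral against the
   n-dimensional Lebesgue measure. *)
Fixpoint iterated_integral (n : nat) : (n.-tuple R -> \bar R) -> \bar R :=
  match n with
  | 0%N => fun F => F [tuple]
  | m.+1 => fun F =>
      (\int[lebesgue_measure]_x
         iterated_integral (fun t : m.-tuple R => F [tuple of x :: t]))%E
  end.

Definition ordered_integral (n : nat) (g : n.-tuple R -> R) : \bar R :=
  iterated_integral ((EFin \o g) \_ [set x | ordered_above_one x]).

Definition J_term (a k n : nat) (r : 'I_n -> 'I_k) : \bar R :=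
  ((psi a 1 ^+ (k - n - \sum_(j < n) alpha r j))%:E *
   ordered_integral (fun x : n.-tuple R =>
     (norm_const a ^+ n *
     (\prod_(j < n) psi a (1 / tnth x j) ^+ alpha r j) /
     \prod_(j < n) (1 + tnth x j ^+ a))%R))%E.

Definition K_term (a k n : nat) (r : 'I_n -> 'I_k) : \bar R :=
  ((phi a 1 ^+ (k - n - \sum_(j < n) alpha r j))%:E *
   ordered_integral (fun x : n.-tuple R =>
     (norm_const a ^+ n *
     (\prod_(j < n) (phi a (1 / tnth x j) ^+ alpha r j * tnth x j ^+ (a - 2))) /
     \prod_(j < n) (1 + tnth x j ^+ a))%R))%E.

End integrals.

Definition cyclic_event (T : Type) (R : realType) (k n : nat)
    (r : 'I_n -> 'I_k) (X : 'I_k -> T -> R) : set T :=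
  [set w | [/\ forall i : 'I_k, X i w * X (ordS i) w < 1,
               ordered_above_one [tuple X (r j) w | j < n] &
               forall z : 'I_k, (forall j : 'I_n, z != r j) -> X z w < 1]].

(* Main.v *)
(* Given the values x of the variables at r_1, ..., r_n, decreasing and at least
   1, the cyclic event only requires every other variable z to lie below a bound
   depending on x: 1 / x_j for the first j with r_j adjacent to z (the tightest
   of the constraints imposed by the neighbours of z), and 1 if there is no such
   j. Two consecutive indices outside the r_j impose nothing more, as the
   variables there are nonnegative and below 1. Integrating the other variables
   out, by independence and Tonelli, leaves psi(1/x_j) to the power alpha_j for
   each j and psi(1) for each of the remaining variables. *)

From HB Require Import structures.
Require Import Defs.
From mathcomp Require Import all_boot all_order all_algebra.
From mathcomp Require Import zify.
From mathcomp Require Import all_classical all_reals all_analysis.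
From mathcomp Require Import measurable_realfun measurable_fun_approximation.

Import Order.TTheory GRing.Theory Num.Theory.
Import numFieldNormedType.Exports.

Local Open Scope classical_set_scope.
Local Open Scope ring_scope.

Set Implicit Arguments.
Unset Strict Implicit.
Unset Printing Implicit Defensive.

(** * Image of a finite measure under a measurable map *)

Section finite_pushforward.
Local Open Scope ereal_scope.
Context d d' (T : measurableType d) (U : measurableType d') (R : realType).
Variables (mu : {finite_measure set T -> \bar R}) (f : T -> U).
Hypothesis mf : measurable_fun setT f.

(** Carrying the proof of measurability in the term lets the finite measure structure be inferred
    from the term itself. *)
Definition finite_pushforward of measurable_fun setT f := pushforward mu f.

Local Notation push := (finite_pushforward mf).

Let push0 : push set0 = 0.
Proof. by rewrite /push /pushforward preimage_set0 measure0. Qed.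

Let push_ge0 A : 0 <= push A.
Proof. exact: measure_ge0. Qed.

Let push_sigma_additive : semi_sigma_additive push.
Proof.
exact: measure_semi_sigma_additive.
Qed.

HB.instance Definition _ :=
  isMeasure.Build _ _ _ push push0 push_ge0 push_sigma_additive.

Let push_fin : fin_num_fun push.
Proof.
move=> A mA; apply: fin_num_measure.
by rewrite -[X in measurable X]setTI; exact: mf.
Qed.

HB.instance Definition _ := Measure_isFinite.Build _ _ _ push push_fin.

Lemma ge0_integral_finite_pushforward (g : U -> \bar R) :
  measurable_fun setT g -> (forall y, 0 <= g y) ->
  \int[push]_y g y = \int[mu]_x g (f x).
Proof.
move=> mg g0; have := @ge0_integral_pushforward _ _ T U R f mf mu setT g.
by rewrite preimage_setT => <-.
Qed.

End finite_pushforward.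

Lemma emeasurable_prod d (T : measurableType d) (R : realType) (I : Type)
    (s : seq I) (h : I -> T -> \bar R) :
  (forall i, measurable_fun setT (h i)) ->
  measurable_fun setT (fun x => \prod_(i <- s) h i x)%E.
Proof.
move=> mh; elim: s => [|i s IH].
  by under eq_fun do rewrite big_nil; exact: measurable_cst.
by under eq_fun do rewrite big_cons; exact: emeasurable_funM.
Qed.

(** * Iterated integrals over a sigma-finite measure *)

Section iterint.
Local Open Scope ereal_scope.
Context d (E : measurableType d) {R : realType}.
Variable mu : {sigma_finite_measure set E -> \bar R}.

(* Over [lebesgue_measure], this is convertible to [iterated_integral]. *)
Fixpoint iterint (n : nat) : (n.-tuple E -> \bar R) -> \bar R :=
  match n with
  | 0%N => fun F => F [tuple]
  | m.+1 => fun F =>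
      \int[mu]_x iterint (fun t : m.-tuple E => F [tuple of x :: t])
  end.

Lemma eq_iterint n (F G : n.-tuple E -> \bar R) :
  F =1 G -> iterint F = iterint G.
Proof. by move=> /funext ->. Qed.

Lemma iterint_ge0 n (F : n.-tuple E -> \bar R) :
  (forall x, 0 <= F x) -> 0 <= iterint F.
Proof.
elim: n F => [|n IH] F F0 //=.
by apply: integral_ge0 => x _; exact: IH.
Qed.

(** The parameter space is arbitrary so that the induction can absorb the first variable into the
    parameter; Tonelli then integrates this variable out. *)
Lemma measurable_iterint d' (S : measurableType d') n
    (F : S -> n.-tuple E -> \bar R) :
  measurable_fun setT (fun p : S * n.-tuple E => F p.1 p.2) ->
  (forall s x, 0 <= F s x) ->
  measurable_fun setT (fun s => iterint (F s)).
Proof.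
elim: n d' S F => [|n IH] d' S F mF F0 /=.
  exact: (measurable_fun_pair1 [tuple] mF).
pose H (p : S * E) := iterint (fun t => F p.1 [tuple of p.2 :: t]).
have mH : measurable_fun setT H.
  apply: IH => // {H}.
  pose u (p : S * E * n.-tuple E) := (p.1.1, [tuple of p.1.2 :: p.2]).
  have mu' : measurable_fun setT u.
    apply: measurable_fun_pair.
      exact: measurableT_comp measurable_fst measurable_fst.
    apply: measurable_cons => //.
    exact: measurableT_comp measurable_snd measurable_fst.
  exact: measurableT_comp mF mu'.
apply: (measurable_fun_fubini_tonelli_F (m2 := mu) H) => // p.
exact: iterint_ge0.
Qed.

Lemma measurable_iterint_cons n (F : n.+1.-tuple E -> \bar R) :
  measurable_fun setT F -> (forall x, 0 <= F x) ->
  measurable_fun setT (fun x => iterint (fun t => F [tuple of x :: t])).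
Proof.
move=> mF F0; apply: measurable_iterint => //.
by apply: (measurableT_comp mF); apply: measurable_cons.
Qed.

Lemma iterintZl n (c : \bar R) (F : n.-tuple E -> \bar R) :
  measurable_fun setT F -> (forall x, 0 <= F x) -> 0 <= c ->
  iterint (fun x => c * F x) = c * iterint F.
Proof.
move=> + + c0; elim: n F => [|n IH] F mF F0 //=.
rewrite -ge0_integralZl//; last first.
- by move=> x _; exact: iterint_ge0.
- exact: measurable_iterint_cons.
apply: eq_integral => x _; apply: IH => //.
by apply: (measurableT_comp mF); apply: measurable_cons.
Qed.

Lemma iterint_cat n m (F : (n + m).-tuple E -> \bar R) :
  iterint F = iterint (fun x : n.-tuple E =>
    iterint (fun y : m.-tuple E => F [tuple of x ++ y])).
Proof.
elim: n F => [|n IH] F /=.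
  by apply: eq_iterint => y; congr F; exact: val_inj.
apply: eq_integral => x _; rewrite IH.
apply: eq_iterint => t; apply: eq_iterint => y.
by congr F; exact: val_inj.
Qed.

Lemma iterint_prod n (h : 'I_n -> E -> \bar R) :
  (forall i, measurable_fun setT (h i)) -> (forall i x, 0 <= h i x) ->
  iterint (fun x => \prod_(i < n) h i (tnth x i)) =
  \prod_(i < n) \int[mu]_x h i x.
Proof.
elim: n h => [|n IH] h mh h0 /=; first by rewrite !big_ord0.
rewrite big_ord_recl -IH// -ge0_integralZr//; last first.
  by apply: iterint_ge0 => x; apply: prode_ge0 => i _.
apply: eq_integral => x _.
rewrite -iterintZl//.
- by apply: eq_iterint => t; rewrite big_ord_recl/=;
    congr (_ * _); apply: eq_bigr => i _; rewrite tnthS.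
- apply: emeasurable_prod => i _.
  exact: (measurableT_comp (mh (lift ord0 i)) (measurable_tnth i)).
- by move=> t; apply: prode_ge0 => i _.
Qed.

End iterint.

Lemma integral_indic_comp d d' (T : measurableType d) (U : measurableType d')
    (R : realType) (mu : {measure set T -> \bar R}) (f : T -> U) (B : set U) :
  measurable_fun setT f -> measurable B ->
  (\int[mu]_x (\1_B (f x))%:E)%E = mu (f @^-1` B).
Proof.
move=> mf mB; rewrite -[in RHS](setIT (f @^-1` B)) -integral_indic//.
by rewrite -[X in measurable X]setTI; exact: mf.
Qed.

(** * Joint law of independent variables *)

Section joint_law.
Local Open Scope ereal_scope.
Context d d' (T : measurableType d) (E : measurableType d') {R : realType}.
Variable nu : probability E R.

(* The induction runs over all finite measures [mu], so that its hypothesis also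
   applies to the restriction of [mu] to an event on the first variable; this
   makes the first variable independent of the tuple of the other ones, as
   Tonelli's theorem requires. *)
Lemma integral_joint_law n (mu : {finite_measure set T -> \bar R})
    (X : 'I_n -> {mfun T >-> E}) :
  (forall A : 'I_n -> set E, (forall i, measurable (A i)) ->
    mu [set w | forall i, A i (X i w)] = mu setT * \prod_(i < n) nu (A i)) ->
  forall F : n.-tuple E -> \bar R, measurable_fun setT F ->
    (forall x, 0 <= F x) ->
  \int[mu]_w F [tuple X i w | i < n] = mu setT * iterint nu F.
Proof.
elim: n mu X => [|n IH] mu X hX F mF F0 /=.
  under eq_integral do rewrite tuple0/=.
  by rewrite integral_cst// muleC (tuple0 [tuple of _]).
pose X' i := X (lift ord0 i).
pose W w := [tuple X' i w | i < n].
have mW : measurable_fun setT W.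
  apply/measurable_fun_tnthP => i.
  by rewrite (_ : _ \o _ = X' i)//; apply/funext => w /=; rewrite tnth_mktuple.
have mXW : measurable_fun setT (fun w => (X ord0 w, W w)).
  exact: measurable_fun_pair.
have mX' (A : 'I_n -> set E) : (forall i, measurable (A i)) ->
    measurable [set w | forall i, A i (X' i w)].
  move=> mA; rewrite (_ : [set w | _] = \bigcap_(i in setT) (X' i @^-1` A i)).
    apply: fin_bigcap_measurable => // i _.
    by rewrite -[X in measurable X]setTI; exact: measurable_funP.
  by apply/seteqP; split => w /= h i; [move=> _|]; apply: h.
have X_cons (A0 : set E) (A : 'I_n -> set E) :
    measurable A0 -> (forall i, measurable (A i)) ->
    mu ([set w | forall i, A i (X' i w)] `&` X ord0 @^-1` A0) =
    mu setT * (nu A0 * \prod_(i < n) nu (A i)).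
  move=> mA0 mA.
  (* [B] glues [A0] and the family [A] into one family over all n+1 indices, to which [hX]
     applies. *)
  pose B i := if unlift ord0 i is Some j then A j else A0.
  have BS j : B (lift ord0 j) = A j by rewrite /B liftK.
  have B0 : B ord0 = A0 by rewrite /B unlift_none.
  transitivity (mu [set w | forall i, B i (X i w)]).
    congr (mu _); apply/seteqP; split => w /=.
      move=> [h1 h2] i.
      by case: (unliftP ord0 i) => [j|] ->; rewrite ?BS ?B0//; exact: h1.
    by move=> h; split=> [i|]; [rewrite -BS; exact: h|rewrite -B0; exact: h].
  rewrite hX; last by move=> i; rewrite /B; case: unlift.
  rewrite big_ord_recl B0; congr (_ * (_ * _)).
  by apply: eq_bigr => i _; rewrite BS.
have nuT : nu setT = 1 by exact: probability_setT.
have hX' (A : 'I_n -> set E) : (forall i, measurable (A i)) ->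
    mu [set w | forall i, A i (X' i w)] = mu setT * \prod_(i < n) nu (A i).
  move=> mA; have := X_cons setT A measurableT mA.
  by rewrite preimage_setT setIT nuT mul1e.
have muX0 A0 : measurable A0 -> mu (X ord0 @^-1` A0) = mu setT * nu A0.
  move=> mA0; have := X_cons A0 (fun=> setT) mA0 (fun=> measurableT).
  rewrite (_ : [set w | _] = setT); last by apply/seteqP; split.
  by rewrite setTI nuT big1// mule1.
have WE (B : set (n.-tuple E)) : measurable B ->
    mu (W @^-1` B) = mu setT * iterint nu (fun x => (\1_B x)%:E).
  move=> mB; rewrite -(IH mu X')//.
    by rewrite (integral_indic_comp _ mW).
  by apply/measurable_EFinP; exact: measurable_indic.
have XWE A0 (B : set (n.-tuple E)) : measurable A0 -> measurable B ->
    mu (W @^-1` B `&` X ord0 @^-1` A0) =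
    mu setT * nu A0 * iterint nu (fun x => (\1_B x)%:E).
  move=> mA0 mB.
  have mXA0 : measurable (X ord0 @^-1` A0).
    by rewrite -[X in measurable X]setTI; exact: measurable_funP.
  have fXA0 : mu (X ord0 @^-1` A0) < +oo.
    by rewrite ltey_eq fin_num_measure.
  (* The induction hypothesis for this restriction yields the rectangle formula, the factor [nu A0]
     coming from its total mass. *)
  pose mu' : {finite_measure set T -> \bar R} := mfrestr mXA0 fXA0.
  have mu'T : mu' setT = mu setT * nu A0.
    by rewrite /mu' /= /mfrestr /mrestr setTI muX0.
  have hmu' (A : 'I_n -> set E) : (forall i, measurable (A i)) ->
      mu' [set w | forall i, A i (X' i w)] = mu' setT * \prod_(i < n) nu (A i).
    by move=> mA; rewrite mu'T /mu' /= /mfrestr /mrestr X_cons// muleA.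
  rewrite -mu'T -(IH mu' X')//.
    by rewrite (integral_indic_comp _ mW).
  by apply/measurable_EFinP; exact: measurable_indic.
pose m2 : {finite_measure set _ -> \bar R} := finite_pushforward mu mW.
pose m12 : {finite_measure set _ -> \bar R} := finite_pushforward mu mXW.
have m12E (A0 : set E) (B : set (n.-tuple E)) : measurable A0 -> measurable B ->
    m12 (A0 `*` B) = nu A0 * m2 B.
  move=> mA0 mB; transitivity (mu (W @^-1` B `&` X ord0 @^-1` A0)).
    by congr (mu _); apply/seteqP; split => w /= [].
  by rewrite XWE// /m2 /= /finite_pushforward /pushforward WE// -muleA muleCA.
pose G (p : E * n.-tuple E) := F [tuple of p.1 :: p.2].
have mG : measurable_fun setT G.
  by apply: (measurableT_comp mF); exact: measurable_cons.
transitivity (\int[mu]_w G (X ord0 w, W w)).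
  apply: eq_integral => w _; rewrite /G; congr F.
  by apply: val_inj; rewrite /= enum_ordSl /= -map_comp.
rewrite -(ge0_integral_finite_pushforward mu mXW mG)//; last first.
  by move=> p; exact: F0.
(* The law [m12] of the pair agrees with the product measure on rectangles, hence everywhere, and
   Tonelli becomes available. *)
transitivity (\int[nu \x m2]_p G p).
  apply: eq_measure_integral => A mA _; apply/esym.
  exact: (product_measure_unique (m' := m12)).
rewrite (fubini_tonelli1 G mG); last by move=> p; exact: F0.
rewrite -ge0_integralZl//; last first.
- by move=> x _; exact: iterint_ge0.
- exact: measurable_iterint_cons.
apply: eq_integral => x _; rewrite /fubini_F.
have mGx : measurable_fun setT (fun y => G (x, y)).
  exact: measurable_fun_pair2.
rewrite (ge0_integral_finite_pushforward mu mW mGx)//; last first.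
  by move=> y; exact: F0.
by apply: (IH mu X') => //= y; exact: F0.
Qed.

End joint_law.

(** * Passing from a law to its density *)

Section density.
Local Open Scope ereal_scope.
Context d (E : measurableType d) {R : realType}.
Variables (nu : probability E R) (lam : {sigma_finite_measure set E -> \bar R}).
Variable f : E -> R.
Hypothesis mf : measurable_fun setT f.
Hypothesis nuE : forall A : set E, measurable A ->
  nu A = \int[lam]_(x in A) (f x)%:E.
Hypothesis f0 : forall x, (0 <= f x)%R.

(** The density has the same integral as the Radon-Nikodym derivative over every measurable set, so
    the two agree almost everywhere and the change of variables for the derivative transfers to
    [f]. *)
Lemma integral_density (g : E -> \bar R) :
  measurable_fun setT g -> (forall x, 0 <= g x) ->
  \int[nu]_x g x = \int[lam]_x (g x * (f x)%:E).
Proof.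
move=> mg g0.
have dom : nu `<< lam.
  apply/null_content_dominatesP => A mA A0.
  rewrite nuE//; apply: null_set_integral => //.
  by apply/measurable_EFinP; exact: measurable_funTS.
rewrite -(Radon_Nikodym_SigmaFinite.change_of_variables dom)//.
have If : lam.-integrable setT (EFin \o f).
  apply/integrableP; split; first exact/measurable_EFinP.
  under eq_integral do rewrite /= ger0_norm//.
  by rewrite -nuE// probability_setT ltry.
have Ih := Radon_Nikodym_SigmaFinite.f_integrable dom.
apply: ae_eq_integral => //.
- by apply: emeasurable_funM => //; exact: measurable_int Ih.
- by apply: emeasurable_funM => //; exact/measurable_EFinP.
- apply: ae_eqe_mul2l; apply: integral_ae_eq => //.
    exact/measurable_EFinP.
  move=> A _ mA; rewrite -nuE//.
  by rewrite -(Radon_Nikodym_SigmaFinite.f_integral dom).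
Qed.

Lemma iterint_density n (F : n.-tuple E -> \bar R) :
  measurable_fun setT F -> (forall x, 0 <= F x) ->
  iterint nu F = iterint lam
    (fun x => F x * (\prod_(i < n) f (tnth x i))%:E).
Proof.
elim: n F => [|n IH] F mF F0 /=; first by rewrite big_ord0 mule1.
rewrite integral_density//; last first.
- by move=> x; exact: iterint_ge0.
- exact: measurable_iterint_cons.
apply: eq_integral => x _.
have mFx : measurable_fun setT (fun t : n.-tuple E => F [tuple of x :: t]).
  by apply: (measurableT_comp mF); apply: measurable_cons.
rewrite IH// muleC -iterintZl ?lee_fin//.
- apply: eq_iterint => t; rewrite big_ord_recl /= EFinM muleCA.
  congr (_ * (_ * _)); congr EFin.
  by apply: eq_bigr => i _; rewrite tnthS.
- apply: emeasurable_funM => //; apply/measurable_EFinP.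
  apply: measurable_prod => i _.
  exact: (measurableT_comp mf (measurable_tnth i)).
- by move=> t; rewrite mule_ge0// lee_fin prodr_ge0.
Qed.

End density.

(** * Combinatorics of the neighbours of the chosen indices *)

Section first_adjacent.
Variables (k n : nat) (r : 'I_n -> 'I_k).

(** The condition on [z] whose solutions [alpha r j] counts. *)
Definition is_first_adjacent (z : 'I_k) (j : 'I_n) : bool :=
  cyc_adjacent z (r j) &&
  [forall m : 'I_n, (m < j)%N ==> ~~ cyc_adjacent z (r m)].

Definition first_adjacent (z : 'I_k) : option 'I_n :=
  [pick j | is_first_adjacent z j].

(** The least index [i] with [r i] adjacent to [z] satisfies the definition, so [pick] cannot fail;
    the minimality clause excludes any result beyond [j]. *)
Lemma first_adjacent_le z j : cyc_adjacent z (r j) ->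
  exists2 i, first_adjacent z = Some i & (i <= j)%N.
Proof.
move=> zj; rewrite /first_adjacent.
case: pickP => [i /andP[zi /forallP fi]|none].
  exists i => //; rewrite leqNgt; apply/negP => ji.
  by have := fi j; rewrite ji zj.
pose i := [arg min_(i < j | cyc_adjacent z (r i)) (i : nat)].
have := none i; rewrite /is_first_adjacent /i; case: arg_minnP => // i' zi' min.
rewrite zi' /= => /negP[]; apply/forallP => m; apply/implyP => mi.
by apply/negP => /min; rewrite leqNgt mi.
Qed.

Lemma first_adjacentP z j :
  (first_adjacent z == Some j) = is_first_adjacent z j.
Proof.
apply/eqP/idP; first by rewrite /first_adjacent; case: pickP => // i ? [<-].
move=> /andP[zj /forallP fj]; have [i iz ij] := first_adjacent_le zj.
rewrite iz; congr Some; apply/val_inj/eqP; rewrite eqn_leq ij leqNgt /=.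
apply/negP => ij'; have := fj i; rewrite ij' /=.
move: iz; rewrite /first_adjacent; case: pickP => // i' /andP[zi' _] [<-].
by rewrite zi'.
Qed.

Lemma first_adjacent_adjacent z j :
  first_adjacent z = Some j -> cyc_adjacent z (r j).
Proof. by move=> /eqP; rewrite first_adjacentP => /andP[]. Qed.

Hypotheses (k_gt1 : (1 < k)%N) (r_nc : cyclically_nonconsecutive r).

Lemma cyclically_nonconsecutive_inj : injective r.
Proof.
move=> i j ij; apply/eqP/negPn/negP => /r_nc.
by rewrite ij subrr inE.
Qed.

(** For distinct indices the excluded difference 1 handles the ordinary successor and k-1 the
    wraparound from k-1 to 0. For equal ones, [k > 1] keeps an element from being its own
    successor. *)
Lemma nonconsecutive_ordS i j : r i != ordS (r j).
Proof.
have [->|/r_nc] := eqVneq i j.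
  apply/eqP => /(congr1 val) /=.
  have := ltn_ord (r j); rewrite leq_eqVlt => /orP[/eqP e|?].
    by rewrite e modnn; lia.
  by rewrite modn_small//; lia.
rewrite !inE !negb_or => nc; apply/eqP => /(congr1 val) /=.
have := ltn_ord (r j); rewrite leq_eqVlt => /orP[/eqP e|?].
  by rewrite e modnn; lia.
by rewrite modn_small//; lia.
Qed.

Lemma nonconsecutive_not_adjacent i j : ~~ cyc_adjacent (r i) (r j).
Proof.
rewrite /cyc_adjacent negb_or nonconsecutive_ordS andbT.
by apply: contra (nonconsecutive_ordS j i) => /eqP->; rewrite ord_predK.
Qed.

Lemma adjacent_notin z j : cyc_adjacent z (r j) -> z \notin codom r.
Proof.
move=> zj; apply/negP => /codomP[i zi]; move: zj.
by rewrite zi (negPf (nonconsecutive_not_adjacent i j)).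
Qed.

Let C := [pred z | z \notin codom r].

Lemma card_notin_codom : #|C| = (k - n)%N.
Proof.
have := cardC (mem (codom r)); rewrite card_codom ?card_ord; last first.
  exact: cyclically_nonconsecutive_inj.
move=> /(congr1 (subn^~ n)); rewrite addKn => <-.
by apply: eq_card => z; rewrite !inE.
Qed.

(** Neighbours of an [r j] lie outside the image of [r], so restricting the count to [C] loses
    nothing. *)
Lemma card_first_adjacent j :
  #|[pred z | C z & first_adjacent z == Some j]| = alpha r j.
Proof.
apply: eq_card => z; rewrite !inE first_adjacentP.
case: (boolP (is_first_adjacent z j)) => [/[dup] /andP[zj _]|nz].
  by rewrite (adjacent_notin zj) => /andP[-> ->].
by rewrite andbF; apply/esym/negbTE.
Qed.

(** The k-n elements of [C] are partitioned by their first adjacent index, and the class of [j] has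
    [alpha r j] elements; in particular the truncated subtraction is exact. *)
Lemma card_no_first_adjacent :
  #|[pred z | C z & first_adjacent z == None]| =
  (k - n - \sum_(j < n) alpha r j)%N.
Proof.
rewrite -card_notin_codom -[#|C|]sum1_card.
rewrite (partition_big first_adjacent xpredT)//= (bigD1 None)//=.
rewrite (reindex_omap Some id)/=; last by case=> //; rewrite eqxx.
rewrite (eq_bigr (alpha r)) => [|j _]; last first.
  by rewrite -card_first_adjacent -sum1_card; apply: eq_bigl => z; rewrite !inE.
rewrite [X in (_ + X)%N](eq_bigl xpredT) => [|j]; last by rewrite eqxx.
by rewrite addnK -sum1_card; apply: eq_bigl => z; rewrite !inE.
Qed.

(** Source of the exponents in [J_term] and [K_term]: the factors are grouped by first adjacent
    index. *)
Lemma prod_first_adjacent (R : comPzRingType) (h : option 'I_n -> R) :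
  \prod_(z in C) h (first_adjacent z) =
  h None ^+ (k - n - \sum_(j < n) alpha r j) *
  \prod_(j < n) h (Some j) ^+ alpha r j.
Proof.
rewrite (partition_big first_adjacent xpredT)//= (bigD1 None)//=.
congr (_ * _).
  rewrite (eq_bigr (fun=> h None)) => [|z /andP[_ /eqP->]//].
  by rewrite prodr_const card_no_first_adjacent.
rewrite (reindex_omap Some id)/=; last by case=> //; rewrite eqxx.
rewrite (eq_bigl xpredT) => [|j]; last by rewrite eqxx.
apply: eq_bigr => j _.
rewrite (eq_bigr (fun=> h (Some j))) => [|z /andP[_ /eqP->]//].
by rewrite prodr_const card_first_adjacent.
Qed.

End first_adjacent.

(** * Decreasing tuples bounded below by 1 *)

Section ordered.
Context {R : realType}.

(** The 1 appended by the definition is also the default value of [nth], so the chain of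
    inequalities may run over all naturals without a bound on [i]. *)
Lemma ordered_above_oneP n (x : n.-tuple R) :
  reflect (forall i, nth 1 x i.+1 <= nth 1 x i) (ordered_above_one x).
Proof.
have rc i : nth 1 (rcons x 1) i = nth 1 x i.
  by rewrite nth_rcons; case: ltngtP => // h; rewrite nth_default// ?h// ltnW.
apply: (iffP (sortedP 1)) => h i; last by rewrite !rc.
have [lt_i|ge_i] := ltnP i (size x).
  by rewrite -!rc; apply: h; rewrite size_rcons.
by rewrite !nth_default// (leq_trans ge_i).
Qed.

Lemma ordered_le n (x : n.-tuple R) (i j : 'I_n) :
  ordered_above_one x -> (i <= j)%N -> tnth x j <= tnth x i.
Proof.
move=> /ordered_above_oneP ox ij; rewrite !(tnth_nth 1).
have /nonincreasing_seqP := ox.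
exact.
Qed.

Lemma ordered_ge1 n (x : n.-tuple R) (i : 'I_n) :
  ordered_above_one x -> 1 <= tnth x i.
Proof.
move=> /ordered_above_oneP ox; rewrite (tnth_nth 1).
have /nonincreasing_seqP h := ox.
(* Position n is just past the end and reads the default value 1. *)
have := h i n (ltnW (ltn_ord i)).
by rewrite nth_default// size_tuple.
Qed.

End ordered.

(** * The cyclic event as upper bounds on the remaining variables *)

Section cyclic_event.
Context {R : realType} (k n : nat) (r : 'I_n -> 'I_k).
Hypotheses (k_gt1 : (1 < k)%N) (r_nc : cyclically_nonconsecutive r).

Definition upper_bound (x : n.-tuple R) (o : option 'I_n) : R :=
  if o is Some j then (tnth x j)^-1 else 1.

(* On an ordered tuple the tightest constraint on a neighbour z of several r_j
   comes from the first of them, whose variable is the largest. *)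
Lemma cyclic_eventE (T : Type) (X : 'I_k -> T -> R) (w : T) :
  (forall i, 0 <= X i w) ->
  cyclic_event r X w <->
  (ordered_above_one [tuple X (r j) w | j < n] /\
   forall z, z \notin codom r ->
     X z w < upper_bound [tuple X (r j) w | j < n] (first_adjacent r z)).
Proof.
set x := [tuple X (r j) w | j < n] => X0.
have xE j : tnth x j = X (r j) w by rewrite tnth_mktuple.
split.
  move=> [Xlt1 ox Xz]; split => // z zr.
  case fz : first_adjacent => [j|] /=; last first.
    by apply: Xz => j; apply: contra zr => /eqP->; exact: codom_f.
  have xj_gt0 : 0 < tnth x j by rewrite (lt_le_trans ltr01)// ordered_ge1.
  rewrite -div1r ltr_pdivlMr// xE.
  (* The constraint used is the one indexed by [z] if [z] precedes [r j], and the one indexed by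
     [r j] if it follows. *)
  have /orP[/eqP->|/eqP->] := first_adjacent_adjacent fz.
    by rewrite -{2}(ord_predK (r j)).
  by rewrite mulrC.
move=> [ox Xz].
have ub_le1 o : upper_bound x o <= 1.
  case: o => [j|] //=; have := ordered_ge1 j ox => xj1.
  by rewrite invf_le1// (lt_le_trans ltr01).
have Xlt1 z : z \notin codom r -> X z w < 1.
  by move=> zr; exact: lt_le_trans (Xz z zr) (ub_le1 _).
have Xadj z j : cyc_adjacent z (r j) -> X z w * X (r j) w < 1.
  move=> zj; have [i fz ij] := first_adjacent_le zj.
  have := Xz z (adjacent_notin k_gt1 r_nc zj); rewrite fz /= => Xzi.
  have xj_gt0 : 0 < tnth x j by rewrite (lt_le_trans ltr01)// ordered_ge1.
  rewrite -xE -ltr_pdivlMr// div1r (lt_le_trans Xzi)// lef_pV2 ?posrE//.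
    exact: ordered_le.
  by rewrite (lt_le_trans ltr01)// ordered_ge1.
split => //.
- move=> i; have [/codomP[j ->]|ir] := boolP (i \in codom r).
    by rewrite mulrC; apply: Xadj; rewrite /cyc_adjacent eqxx orbT.
  have [/codomP[j Sij]|Sir] := boolP (ordS i \in codom r).
    by rewrite Sij; apply: Xadj; rewrite /cyc_adjacent -Sij ordSK eqxx.
  (* Neither index is chosen: both values are nonnegative and below 1. *)
  by apply: mulr_ilt1 => //; exact: Xlt1.
- move=> z zr; apply: Xlt1; apply/negP => /codomP[j zj].
  by have := zr j; rewrite zj eqxx.
Qed.

End cyclic_event.

(** * Measurability of the events and bounds *)

Section measurability.
Context {R : realType}.
Local Notation E := (measurableTypeR R).

(* [lebesgue_measure] lives on [measurableTypeR R], whose measurable structure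
   is not convertible to the default one on [R]: the two identities below
   convert between them. *)
Lemma measurable_from_measurableTypeR : measurable_fun [set: E] (id : E -> R).
Proof. by move=> _ A mA; rewrite setTI. Qed.

Lemma measurable_to_measurableTypeR : measurable_fun [set: R] (id : R -> E).
Proof. by move=> _ A mA; rewrite setTI. Qed.

Lemma measurable_tnth_real n (i : 'I_n) :
  measurable_fun [set: n.-tuple E] (fun x => tnth x i : R).
Proof.
exact: (measurableT_comp measurable_from_measurableTypeR (measurable_tnth i)).
Qed.

(** On the nonnegative half-line the inverse is the real power of exponent -1, also at 0, where both
    are 0; negative arguments follow since the inverse is odd. *)
Lemma measurable_invr : measurable_fun [set: R] (fun x : R => x^-1).
Proof.
rewrite (_ : (fun x => _) =
  fun x : R => if 0 <= x then x `^ (-1) else - (- x) `^ (-1)); last first.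
  apply/funext => x; case: ifPn => x0; first by rewrite powR_inv1.
  by rewrite powR_inv1 ?oppr_ge0 1?ltW ?ltNge// invrN opprK.
apply: measurable_fun_ifT.
- exact: measurable_fun_ler.
- exact: measurable_powR.
- have mN : measurable_fun [set: R] (fun x : R => - x).
    exact: measurable_funN.
  exact: (measurable_funN (measurableT_comp (measurable_powR (-1)) mN)).
Qed.

Lemma measurable_set_bool d (S : measurableType d) (b : S -> bool) :
  measurable_fun setT b -> measurable [set x | b x].
Proof. by move=> /(_ measurableT [set true]); rewrite setTI; apply. Qed.

Lemma measurable_lt t : measurable [set x : E | (x : R) < t].
Proof.
apply: (@measurable_set_bool _ E (fun x : E => (x : R) < t)).
by apply: measurable_fun_ltr => //; exact: measurable_from_measurableTypeR.
Qed.

Lemma measurable_ordered_above_one n :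
  measurable [set x : n.-tuple E | ordered_above_one (x : n.-tuple R)].
Proof.
have mnth i : measurable_fun [set: n.-tuple E]
    (fun x => nth 1 (x : n.-tuple R) i : R).
  have [lt_in|ge_in] := ltnP i n.
    rewrite (_ : (fun x => _) =
      fun x : n.-tuple E => tnth x (Ordinal lt_in) : R).
      exact: measurable_tnth_real.
    by apply/funext => x; rewrite (tnth_nth (1 : R)).
  rewrite (_ : (fun x => _) = cst 1); first exact: measurable_cst.
  by apply/funext => x; rewrite nth_default// size_tuple.
rewrite (_ : [set x | _] = \bigcap_i
    [set x : n.-tuple E |
       nth 1 (x : n.-tuple R) i.+1 <= nth 1 (x : n.-tuple R) i]).
  apply: bigcap_measurable => // i _.
  by apply: measurable_set_bool; exact: measurable_fun_ler.
apply/seteqP; split => x /=.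
  by move/ordered_above_oneP => h i _; exact: h.
by move=> h; apply/ordered_above_oneP => i; exact: h.
Qed.

Lemma measurable_upper_bound n o :
  measurable_fun [set: n.-tuple E]
    (fun x => upper_bound (x : n.-tuple R) o : R).
Proof.
case: o => [j|] /=; last exact: measurable_cst.
exact: (measurableT_comp measurable_invr (measurable_tnth_real j)).
Qed.

Context d (S : measurableType d) (k n : nat) (r : 'I_n -> 'I_k).
Variable X : 'I_k -> S -> R.
Hypothesis mX : forall i, measurable_fun setT (X i).

Lemma measurable_subtuple :
  measurable_fun setT (fun w => [tuple X (r j) w | j < n] : n.-tuple E).
Proof.
apply/measurable_fun_tnthP => i.
rewrite (_ : _ \o _ = X (r i)); last first.
  by apply/funext => w /=; rewrite tnth_mktuple.
exact: (measurableT_comp measurable_to_measurableTypeR (mX (r i))).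
Qed.

Let measurable_ordered_subtuple :
  measurable [set w | ordered_above_one [tuple X (r j) w | j < n]].
Proof.
have := measurable_subtuple measurableT (@measurable_ordered_above_one n).
by rewrite setTI.
Qed.

Lemma measurable_cyclic_event : measurable (cyclic_event r X).
Proof.
rewrite (_ : cyclic_event r X =
    \bigcap_(i in [set: 'I_k]) [set w | X i w * X (ordS i) w < 1] `&`
    ([set w | ordered_above_one [tuple X (r j) w | j < n]] `&`
     \bigcap_(z in [set z | forall j, z != r j])
       [set w | X z w < 1])); last first.
  apply/seteqP; split => w /=.
    by move=> [h1 h2 h3]; split; [move=> i _; exact: h1|split].
  by move=> [h1 [h2 h3]]; split => // i; exact: h1.
apply: measurableI; last apply: measurableI => //.
- apply: fin_bigcap_measurable => [|i _]; first exact: finite_finset.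
  apply: measurable_set_bool.
  by apply: measurable_fun_ltr => //; exact: measurable_funM.
- apply: fin_bigcap_measurable => [|i _]; first exact: finite_finset.
  apply: measurable_set_bool.
  exact: measurable_fun_ltr.
Qed.

Lemma measurable_bounded_event : measurable
  [set w | ordered_above_one [tuple X (r j) w | j < n] /\
   forall z, z \notin codom r ->
     X z w < upper_bound [tuple X (r j) w | j < n] (first_adjacent r z)].
Proof.
rewrite (_ : [set w | _] =
    [set w | ordered_above_one [tuple X (r j) w | j < n]] `&`
    \bigcap_(z in [set z | z \notin codom r]) [set w | X z w <
       upper_bound [tuple X (r j) w | j < n] (first_adjacent r z)]); last first.
  by apply/seteqP; split => w /= [].
apply: measurableI => //.
apply: fin_bigcap_measurable => [|z _]; first exact: finite_finset.
apply: measurable_set_bool.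
apply: measurable_fun_ltr => //.
exact: (measurableT_comp (measurable_upper_bound _) measurable_subtuple).
Qed.

End measurability.

(** * Reordering the indices into two blocks *)

Section reindexing.
Context (k n : nat) (r : 'I_n -> 'I_k).
Hypothesis r_inj : injective r.

Let C := [pred z | z \notin codom r].

(* Lists the r_j first and then the other indices, so that an iterated integral
   over all variables splits into the two groups. *)
Definition outer_inner (i : 'I_(n + #|C|)) : 'I_k :=
  match fintype.split i with inl j => r j | inr l => enum_val l end.

Lemma outer_inner_lshift j : outer_inner (lshift _ j) = r j.
Proof. by rewrite /outer_inner -[lshift _ j]/(unsplit (inl j)) unsplitK. Qed.

Lemma outer_inner_rshift l : outer_inner (rshift _ l) = enum_val l.
Proof. by rewrite /outer_inner -[rshift _ l]/(unsplit (inr l)) unsplitK. Qed.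

Lemma outer_inner_bij : bijective outer_inner.
Proof.
apply: inj_card_bij.
  move=> i j; rewrite -(splitK i) -(splitK j).
  case: (fintype.split i) (fintype.split j) => [a|a] [b|b] /=;
    rewrite ?outer_inner_lshift ?outer_inner_rshift => e.
  - by rewrite (r_inj e).
  - by have := enum_valP b; rewrite inE -e codom_f.
  - by have := enum_valP a; rewrite inE e codom_f.
  - by rewrite (enum_val_inj e).
(* An injection is bijective once [k <= n + #|C|]; this holds because the image of [r] has n
   elements and [C] is its complement. *)
rewrite !card_ord -{1}(card_ord k) -(cardC (mem (codom r))) card_codom//.
by rewrite card_ord leq_add2l; apply: eq_leq; apply: eq_card => z; rewrite !inE.
Qed.

End reindexing.

(** Unfolds to [psi a] or [phi a] when [f] is [f_Xi a] or [f_Theta a], so both events can be treated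
    at once. *)
Definition cdf {R : realType} (f : R -> R) (t : R) : R :=
  Rintegral lebesgue_measure `[0, t] f.

(** * Probability of the cyclic event for a general density on the half-line *)

Section cyclic_event_probability.
Context d (T : measurableType d) {R : realType} (P : probability T R).
Context (k n : nat) (r : 'I_n -> 'I_k).
Hypotheses (k_gt1 : (1 < k)%N) (r_nc : cyclically_nonconsecutive r).
Variables (X : 'I_k -> {RV P >-> R}) (f : R -> R).
Hypothesis X_iid : iid_with_density X f.
Hypotheses (mf : measurable_fun setT f) (f_ge0 : forall x, 0 <= f x).
Hypothesis f_neg : forall x, x < 0 -> f x = 0.

Local Notation E := (measurableTypeR R).
Local Notation lam := (@lebesgue_measure R).
Local Notation F := (cdf f).

Let C := [pred z | z \notin codom r].

Let i0 : 'I_k := Ordinal (ltnW k_gt1).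

Let mX (i : 'I_k) : measurable_fun [set: T] (X i : T -> E).
Proof.
exact: (measurableT_comp measurable_to_measurableTypeR
  (measurable_funPT (X i))).
Qed.

Let Y (i : 'I_k) : {mfun T >-> E} :=
  HB.pack (X i : T -> E) (isMeasurableFun.Build _ _ T E _ (mX i)).

(** The common law of all the variables, read off at an arbitrary index. *)
Let nu : probability E R := distribution P (Y i0).

Let nuE (A : set E) : measurable A ->
  nu A = (\int[lam]_(x in A) (f x)%:E)%E.
Proof. by move=> mA; have [_ /(_ i0 A mA)] := X_iid. Qed.

Let mfE : measurable_fun [set: E] (f : E -> R).
Proof. exact: (measurableT_comp mf measurable_from_measurableTypeR). Qed.

(** The density vanishes below 0 and the endpoint [t] is Lebesgue-null; for negative [t] both sides
    are 0. *)
Let nu_lt t : nu [set x : E | (x : R) < t] = (F t)%:E.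
Proof.
have mt := measurable_lt t.
have FE : nu [set x : E | (x : R) < t] =
    (\int[lam]_(x in `[0%R, t]) (f x)%:E)%E.
  rewrite nuE//.
  rewrite (_ : [set x : E | (x : R) < t] = `]-oo, t[%classic); last first.
    by apply/seteqP; split => x /=; rewrite in_itv.
  rewrite integral_itv_bndo_bndc; last first.
    by apply/measurable_EFinP; exact: measurable_funTS.
  rewrite integral_mkcond [RHS]integral_mkcond; apply: eq_integral => x _.
  rewrite !patchE; have [x0|x0] := ltP x 0.
    by rewrite f_neg//; do 2 case: ifP.
  suff -> : (x \in `]-oo, t]%classic) = (x \in `[0, t]%classic) by [].
  by apply/idP/idP; rewrite !inE /= !in_itv /= x0.
by rewrite /cdf /Rintegral -FE fineK// fin_num_measure.
Qed.

Let F_ge0 t : 0 <= F t.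
Proof. by rewrite -lee_fin -nu_lt. Qed.

(** By [nu_lt], [F] inherits monotonicity from the measure [nu]. *)
Let mF : measurable_fun setT F.
Proof.
apply: nondecreasing_measurable => // s t st.
rewrite -lee_fin -!nu_lt le_measure ?inE//.
- exact: measurable_lt.
- exact: measurable_lt.
- by move=> x /= /lt_le_trans; exact.
Qed.

Lemma iid_prob_all (A : 'I_k -> set R) : (forall i, measurable (A i)) ->
  P [set w | forall i, A i (X i w)] = (\prod_(i < k) nu (A i))%E.
Proof.
move=> mA; have [ind dens] := X_iid.
transitivity
  (P [set w | forall i : 'I_k, i \in [set: 'I_k]%SET -> A i (X i w)]).
  congr (P _); apply/seteqP; split => w /= h i; [move=> _|]; apply: h.
  by rewrite inE.
rewrite (ind [set: 'I_k]%SET A mA).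
apply: eq_big => [i|i _]; first by rewrite inE.
by rewrite nuE; [exact: (dens i _ (mA i))|exact: mA].
Qed.

Lemma prob_cyclic_event :
  P (cyclic_event r (fun i => X i : T -> R)) =
  ((F 1 ^+ (k - n - \sum_(j < n) alpha r j))%:E *
   ordered_integral (fun x : n.-tuple R =>
     (\prod_(j < n) f (tnth x j) *
      \prod_(j < n) F (1 / tnth x j) ^+ alpha r j)%R))%E.
Proof.
have r_inj := cyclically_nonconsecutive_inj r_nc.
have [tau sigK tauK] := outer_inner_bij r_inj.
set sig := @outer_inner k n r in sigK tauK.
pose N := (n + #|C|)%N.
pose U w := [tuple Y (sig i) w | i < N].
have mU : measurable_fun setT U.
  apply/measurable_fun_tnthP => i.
  rewrite (_ : _ \o _ = Y (sig i))//.
  by apply/funext => w /=; rewrite tnth_mktuple.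
(* [Z i] recovers the variable of original index [i] from the reordered tuple. *)
pose Z (i : 'I_k) (x : N.-tuple E) : R := tnth x (tau i).
have mZ i : measurable_fun setT (Z i) by exact: measurable_tnth_real.
pose A := cyclic_event r Z.
pose B := [set x : N.-tuple E | ordered_above_one [tuple Z (r j) x | j < n] /\
   forall z, z \notin codom r ->
     Z z x < upper_bound [tuple Z (r j) x | j < n] (first_adjacent r z)].
have mA : measurable A by exact: measurable_cyclic_event.
have mB : measurable B by exact: measurable_bounded_event.
have mind m (D : set (m.-tuple E)) : measurable D ->
    measurable_fun setT (fun x => (\1_D x : R)%:E).
  by move=> mD; apply/measurable_EFinP; exact: measurable_indic.
have ind_ge0 m (D : set (m.-tuple E)) x : (0 <= (\1_D x : R)%:E)%E.
  by rewrite lee_fin.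
(* Independence enters here: the reordered vector [U] has as law the product of copies of [nu]. *)
have PA : P (cyclic_event r (fun i => X i : T -> R)) =
    iterint nu (fun x => (\1_A x)%:E).
  transitivity (P (U @^-1` A)).
    congr (P _); rewrite /A /cyclic_event /preimage /=; apply/seteqP.
    have UZ w i : Z i (U w) = X i w by rewrite /Z tnth_mktuple tauK.
    have UZs w : [tuple Z (r j) (U w) | j < n] = [tuple X (r j) w | j < n].
      by apply: eq_from_tnth => j; rewrite !tnth_mktuple UZ.
    split => w /= [h1 h2 h3]; split.
    - by move=> i; rewrite !UZ.
    - by rewrite UZs.
    - by move=> z zr; rewrite UZ; exact: h3.
    - by move=> i; rewrite -!UZ.
    - by rewrite -UZs.
    - by move=> z zr; rewrite -UZ; exact: h3.
  rewrite -(integral_indic_comp _ mU)// /U.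
  have indep (D : 'I_N -> set E) : (forall i, measurable (D i)) ->
      P [set w | forall i, D i (Y (sig i) w)] =
      (P setT * \prod_(i < N) nu (D i))%E.
    move=> mD; rewrite probability_setT mul1e.
    transitivity (P [set w | forall i, D (tau i) (X i w)]).
      congr (P _); apply/seteqP; split => w /= h i.
        by have := h (tau i); rewrite tauK.
      by have := h (sig i); rewrite sigK.
    rewrite (iid_prob_all (A := fun i => D (tau i))); last first.
      by move=> i; exact: mD.
    rewrite (reindex sig); last by exists tau => ? _; [exact: sigK|exact: tauK].
    by apply: eq_bigr => i _; rewrite sigK.
  transitivity (P setT * iterint nu (fun x => (\1_A x)%:E))%E.
    exact: (integral_joint_law indep (mind _ _ mA) (ind_ge0 _ _)).
  by rewrite probability_setT mul1e.
(* The indicators are compared under Lebesgue measure: [cyclic_eventE] covers nonnegative tuples,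
   and a negative coordinate makes the product of densities vanish. *)
have PB : iterint nu (fun x => (\1_A x)%:E) = iterint nu (fun x => (\1_B x)%:E).
  rewrite !(iterint_density (lam := lam) mfE nuE f_ge0)//; [|exact: mind..].
  apply: eq_iterint => x.
  have [x_ge0|] := pselect (forall i, 0 <= (tnth x i : R)).
    rewrite !indicE; suff -> : (x \in A) = (x \in B) by [].
    apply/idP/idP; rewrite !inE => h.
      by apply/(cyclic_eventE k_gt1 r_nc) => // i; exact: x_ge0.
    by apply/(cyclic_eventE k_gt1 r_nc) => // i; exact: x_ge0.
  move=> /existsNP[i /negP]; rewrite -ltNge => xi0.
  by rewrite (bigD1 i)//= f_neg// mul0r !mule0.
pose O := [set x : n.-tuple E | ordered_above_one (x : n.-tuple R)].
have mO : measurable O by exact: measurable_ordered_above_one.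
pose c (x : n.-tuple E) (z : 'I_k) : R :=
  upper_bound (x : n.-tuple R) (first_adjacent r z).
pose G (x : n.-tuple E) : R := \prod_(j < n) F (1 / tnth x j) ^+ alpha r j.
have mG : measurable_fun setT G.
  apply: measurable_prod => j _; apply: measurable_funX.
  have mj : measurable_fun [set: n.-tuple E] (fun x => 1 / tnth x j : R).
    under eq_fun do rewrite div1r.
    exact: (measurableT_comp measurable_invr (measurable_tnth_real j)).
  exact: (measurableT_comp mF mj).
have G_ge0 x : 0 <= G x.
  by apply: prodr_ge0 => j _; exact: exprn_ge0.
have inner (x : n.-tuple E) :
    iterint nu (fun y : #|C|.-tuple E => (\1_B [tuple of x ++ y])%:E) =
    ((F 1 ^+ (k - n - \sum_(j < n) alpha r j))%:E * (\1_O x * G x)%:E)%E.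
  (* For a fixed outer block [x], membership in [B] splits into the ordering of [x] and one separate
     bound for each inner variable. *)
  transitivity (iterint nu (fun y : #|C|.-tuple E => (\1_O x)%:E *
      \prod_(l < #|C|)
        (\1_[set t : E | (t : R) < c x (enum_val l)] (tnth y l))%:E))%E.
    apply: eq_iterint => y; rewrite prodEFin -EFinM; congr EFin.
    have Zr j : Z (r j) [tuple of x ++ y] = tnth x j.
      rewrite /Z -(outer_inner_lshift r j) sigK.
      by rewrite !(tnth_nth 0) /= nth_cat size_tuple ltn_ord.
    have Zrs : [tuple Z (r j) [tuple of x ++ y] | j < n] = x.
      by apply: eq_from_tnth => j; rewrite tnth_mktuple Zr.
    have Zl l : Z (enum_val l) [tuple of x ++ y] = tnth y l.
      rewrite /Z -(outer_inner_rshift l) sigK.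
      by rewrite !(tnth_nth 0) /= nth_cat size_tuple ltnNge leq_addr addKn.
    have [[Bo Bz]|nB] := pselect (B [tuple of x ++ y]).
      rewrite indicE mem_set// indicE mem_set; last by rewrite /O /= -Zrs.
      rewrite big1 ?mulr1// => l _; rewrite indicE mem_set//= -Zl.
      have := Bz (enum_val l) (enum_valP l).
      by rewrite Zrs.
    rewrite indicE memNset//; apply/esym/eqP; rewrite mulf_eq0.
    have [ox|nox] := pselect (O x); last by rewrite indicE memNset// eqxx.
    (* With [x] ordered, if no factor vanished, every bound would hold and the point would lie in
       [B]. *)
    apply/orP; right; apply/eqP; apply: contrapT => /eqP/prodf_neq0 h.
    apply: nB; split; first by rewrite Zrs.
    move=> z zr; rewrite Zrs.
    have zC : z \in C by rewrite inE.
    have := h (enum_rank_in zC z) isT; rewrite indicE -Zl enum_rankK_in//.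
    by case: (boolP (_ \in _)) => [|_]; rewrite ?inE ?eqxx.
  rewrite iterintZl//.
  - rewrite (iterint_prod nu (h := fun l t =>
      (\1_[set t : E | (t : R) < c x (enum_val l)] t)%:E))%E//.
    rewrite (eq_bigr (fun l => (F (c x (enum_val l)))%:E)); last first.
      move=> l _; rewrite integral_indic; last 2 first.
      - exact: measurableT.
      - exact: measurable_lt.
      by rewrite setIT; exact: nu_lt.
    rewrite prodEFin -!EFinM mulrCA; congr (_ * _)%:E.
    rewrite -(big_enum_val (A := C) (fun z => F (c x z))) /c.
    rewrite (prod_first_adjacent k_gt1 r_nc
      (fun o => F (upper_bound (x : n.-tuple R) o))) /=.
    by congr (_ * _); apply: eq_bigr => j _; rewrite div1r.
    move=> l; apply/measurable_EFinP.
    exact: (measurable_indic (measurable_lt _)).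
  - apply: emeasurable_prod => l.
    apply/measurable_EFinP.
    exact: (measurableT_comp (measurable_indic (measurable_lt _))
      (measurable_tnth l)).
  - by move=> y; apply: prode_ge0 => l _; rewrite lee_fin.
rewrite PA PB /N iterint_cat (eq_iterint _ inner).
have mOG : measurable_fun setT (fun x => (\1_O x * G x)%:E).
  by apply/measurable_EFinP; exact: measurable_funM.
have OG_ge0 x : (0 <= (\1_O x * G x)%:E)%E by rewrite lee_fin mulr_ge0.
rewrite iterintZl ?lee_fin ?exprn_ge0//; congr (_ * _)%E.
rewrite (iterint_density (lam := lam) mfE nuE f_ge0)//.
(* Over Lebesgue measure this iterated integral is [ordered_integral] by conversion. *)
transitivity (iterint lam
  ((EFin \o (fun x : n.-tuple R => \prod_(j < n) f (tnth x j) * G x)) \_ O))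
  => //.
apply: eq_iterint => x; rewrite patchE indicE; case: ifP => _.
  by rewrite mul1r -EFinM mulrC.
by rewrite mul0r mul0e.
Qed.

End cyclic_event_probability.

(** * Specialization to the two densities *)

Section densities.
Context {R : realType}.

Lemma eq_ordered_integral n (g h : n.-tuple R -> R) :
  (forall x, ordered_above_one x -> g x = h x) ->
  ordered_integral g = ordered_integral h.
Proof.
move=> gh; rewrite /ordered_integral; congr (iterated_integral _).
apply/funext => x; rewrite !patchE; case: ifPn => //.
by rewrite inE => /gh /= ->.
Qed.

(** Since [1 <= a], the angle [pi / a] lies in [0, pi], where the sine is nonnegative. *)
Lemma norm_const_ge0 a : (2 <= a)%N -> 0 <= norm_const a :> R.
Proof.
move=> a2; have a1 : 1 <= a%:R :> R by rewrite ler1n ltnW.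
have a_gt0 : 0 < a%:R :> R by rewrite (lt_le_trans ltr01).
apply: mulr_ge0; first by rewrite divr_ge0// pi_ge0.
apply: sin_ge0_pi; rewrite divr_ge0 ?pi_ge0//=.
by rewrite ler_pdivrMr// ler_peMr// pi_ge0.
Qed.

Lemma measurable_nonneg_quotient (p q : R -> R) :
  measurable_fun setT p -> measurable_fun setT q ->
  measurable_fun setT (fun x : R => if 0 <= x then p x / q x else 0).
Proof.
move=> mp mq; apply: measurable_fun_ifT.
- exact: measurable_fun_ler.
- by apply: measurable_funM => //; exact: (measurableT_comp measurable_invr mq).
- exact: measurable_cst.
Qed.

Lemma measurable_add1X a : measurable_fun setT (fun x : R => 1 + x ^+ a).
Proof. by apply: measurable_funD => //; exact: exprn_measurable. Qed.

Lemma measurable_f_Xi a : measurable_fun setT (f_Xi a : R -> R).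
Proof.
apply: measurable_nonneg_quotient; first exact: measurable_cst.
exact: measurable_add1X.
Qed.

Lemma measurable_f_Theta a : measurable_fun setT (f_Theta a : R -> R).
Proof.
apply: measurable_nonneg_quotient; last exact: measurable_add1X.
by apply: measurable_funM => //; exact: exprn_measurable.
Qed.

Lemma f_Xi_ge0 a x : (2 <= a)%N -> 0 <= f_Xi a x :> R.
Proof.
move=> a2; rewrite /f_Xi; case: ifP => // x0.
apply: divr_ge0; first exact: norm_const_ge0.
by apply: addr_ge0 => //; exact: exprn_ge0.
Qed.

Lemma f_Theta_ge0 a x : (2 <= a)%N -> 0 <= f_Theta a x :> R.
Proof.
move=> a2; rewrite /f_Theta; case: ifP => // x0.
apply: divr_ge0.
  by apply: mulr_ge0; [exact: norm_const_ge0|exact: exprn_ge0].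
by apply: addr_ge0 => //; exact: exprn_ge0.
Qed.

Context d (T : measurableType d) (P : probability T R).
Context (a k n : nat) (r : 'I_n -> 'I_k).
Hypotheses (a_ge2 : (2 <= a)%N) (k_gt1 : (1 < k)%N).
Hypothesis r_nc : cyclically_nonconsecutive r.

Let tnth_ge0 (x : n.-tuple R) j : ordered_above_one x -> 0 <= tnth x j.
Proof. by move=> /(ordered_ge1 j); exact: le_trans ler01. Qed.

Lemma prob_cyclic_event_Xi (X : 'I_k -> {RV P >-> R}) :
  iid_with_density X (f_Xi a) ->
  P (cyclic_event r (fun i => X i : T -> R)) = J_term a r.
Proof.
move=> X_iid; rewrite (prob_cyclic_event k_gt1 r_nc X_iid).
- congr (_ * _)%E; apply: eq_ordered_integral => x ox.
  (* Coordinates of an ordered tuple are at least 1, which selects the nonnegative branch of the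
     density. *)
  rewrite (eq_bigr (fun j => norm_const a / (1 + tnth x j ^+ a))); last first.
    by move=> j _; rewrite /f_Xi tnth_ge0.
  by rewrite big_split /= prodr_const card_ord prodfV mulrAC.
- exact: measurable_f_Xi.
- by move=> x; exact: f_Xi_ge0.
- by move=> x x0; rewrite /f_Xi leNgt x0.
Qed.

Lemma prob_cyclic_event_Theta (X : 'I_k -> {RV P >-> R}) :
  iid_with_density X (f_Theta a) ->
  P (cyclic_event r (fun i => X i : T -> R)) = K_term a r.
Proof.
move=> X_iid; rewrite (prob_cyclic_event k_gt1 r_nc X_iid).
- congr (_ * _)%E; apply: eq_ordered_integral => x ox.
  rewrite (eq_bigr (fun j =>
    norm_const a * tnth x j ^+ (a - 2) / (1 + tnth x j ^+ a))); last first.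
    by move=> j _; rewrite /f_Theta tnth_ge0.
  rewrite 2!big_split /= prodr_const card_ord prodfV [in RHS]big_split /=.
  by rewrite -!mulrA; congr (_ * _); rewrite mulrA mulrC.
- exact: measurable_f_Theta.
- by move=> x; exact: f_Theta_ge0.
- by move=> x x0; rewrite /f_Theta leNgt x0.
Qed.

End densities.

Theorem theorem2p3p5 (R : realType) (d : measure_display)
    (T : measurableType d) (P : probability T R)
    (a k n : nat) (r : 'I_n -> 'I_k)
    (Xi Theta : 'I_k -> {RV P >-> R}) :
  (2 <= a)%N -> (1 <= k)%N -> (1 <= n)%N -> (n <= k %/ 2)%N ->
  cyclically_nonconsecutive r ->
  iid_with_density Xi (f_Xi a) ->
  iid_with_density Theta (f_Theta a) ->
  (P (cyclic_event r (fun i => Xi i : T -> R)) +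
   P (cyclic_event r (fun i => Theta i : T -> R)))%E =
  (J_term a r + K_term a r)%E.
Proof.
move=> a_ge2 _ n_gt0 le_n_k2 r_nc Xi_iid Theta_iid.
(* [1 <= n <= k %/ 2] forces k to be at least 2. *)
have k_gt1 : (1 < k)%N by lia.
congr (_ + _)%E; first exact: prob_cyclic_event_Xi.
exact: prob_cyclic_event_Theta.
Qed.
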